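(* Let $s\ge 2$ and $n$ be positive integers and let $t_1,\ldots,t_s$ be integers with $0\le t_i<s$ for each $1\le i\le s$ and $n\ge t_1+\cdots+t_s$. Suppose that $\mathcal{F}\subset [s]^n$ is $(t_1,\ldots,t_s)$-intersecting. Then $$|\mathcal{F}|\le s^{\,n-\sum_{i=1}^s t_i}.$$
   Context: $[s]=\{1,\ldots,s\}$ and $[s]^n$ is the set of all sequences $\vec y=(y_1,\ldots,y_n)$ with $y_j\in[s]$. For non-negative integers $t_1,\ldots,t_s$, a family $\mathcal{F}\subset[s]^n$ is called $(t_1,\ldots,t_s)$-intersecting if for all $\vec y,\vec z\in\mathcal{F}$ (not necessarily distinct) and every $\ell\in[s]$, the number of coordinates $j\in[n]$ with $y_j=z_j=\ell$ is at least $t_\ell$. *)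

(* Defs.v *)
From mathcomp Require Import all_boot.

Set Implicit Arguments.
Unset Strict Implicit.
Unset Printing Implicit Defensive.

(* The alphabet [s] = {1, ..., s} is 'I_s = {0, ..., s - 1}, so t l stands for
   t_(l+1); a sequence in [s]^n is a finite function 'I_n -> 'I_s.
   The case y = z is included. *)
Definition t_intersecting (s n : nat) (t : 'I_s -> nat)
    (F : {set {ffun 'I_n -> 'I_s}}) : Prop :=
  forall y z : {ffun 'I_n -> 'I_s}, y \in F -> z \in F ->
  forall l : 'I_s, t l <= #|[set j : 'I_n | (y j == l) && (z j == l)]|.

(* Main.v *)
Require Import Defs.
From mathcomp Require Import all_boot.
From mathcomp Require Import all_order all_algebra.
From mathcomp Require Import zify ring.

(* For each letter l let U_l be the set of sequences whose l-positions contain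
   those of some member of F. Any two members of U_l agree in at least t_l
   places, so |U_l| <= s^(n - t_l) by Delsarte's linear programming bound in the
   Hamming scheme: as t_l <= s - 1, there is a nonnegative dual solution, shaped
   like the weight distribution of an MDS code. The indicator of U_l is
   increasing in the set of l-positions, and for a uniform random sequence the
   sets of l-positions for the various l are negatively associated, so the
   densities of the U_l multiply: |F| / s^n <= prod_l |U_l| / s^n. *)

Set Implicit Arguments.
Unset Strict Implicit.
Unset Printing Implicit Defensive.

Import Order.TTheory GRing.Theory Num.Theory.

(** * Nonnegative dual weights and the linear functional they define *)

Section Weights.

Local Open Scope ring_scope.

Variable m : int.

(* With m = s - 1, weight t k / m^k is the dual solution of Delsarte's linear
   program. The recurrence makes the functional X^k |-> weight t k send
   (X + 1)^t p to s^t p(m), see weightp_horner. *)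
Fixpoint weight (t k : nat) : int :=
  match t with
  | 0%N => m ^+ k
  | t'.+1 => (fix weight_t k := match k with
      | 0%N => (m + 1) ^+ t'.+1
      | k'.+1 => (m + 1) * weight t' k' - weight_t k'
      end) k
  end.

Lemma weight0 t : weight t 0 = (m + 1) ^+ t.
Proof. by case: t. Qed.

Lemma weightSS t k :
  weight t.+1 k.+1 = (m + 1) * weight t k - weight t.+1 k.
Proof. by []. Qed.

Lemma weight1 t : weight t.+1 1 = 0.
Proof. by rewrite weightSS !weight0 exprS subrr. Qed.

(** The defining recurrence subtracts, which hides signs; at fixed [t] the correction has an
    explicit alternating sign. Induction on [t], then on [k], with Pascal's rule. *)
Lemma weight_rec t k :
  weight t.+1 k.+2 =
    m * weight t.+1 k.+1 + (-1) ^+ (k + t) * m * (m + 1) ^+ t.+1 * 'C(k, t)%:R.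
Proof.
elim: t k => [|t IHt] k.
  elim: k => [|k IHk].
    by rewrite weightSS !weight1 /= bin0 /=; ring.
  rewrite (weightSS 0 k.+2) {1}IHk (weightSS 0 k.+1) !bin0 /= !addn0 !exprS.
  ring.
elim: k => [|k IHk].
  by rewrite weightSS !weight1 bin_small //=; ring.
rewrite (weightSS t.+1 k.+2) {1}IHk IHt (weightSS t.+1 k.+1) binS natrD.
rewrite !addSn !addnS !exprS.
ring.
Qed.

(** The ratio of the binomials is [(k+1)/(k+1-t)], and [(t+1)(k+1-t) - (k+1) = t(k-t)]. *)
Lemma bin_succ_le (k t : nat) : (t <= k)%N -> ('C(k.+1, t) <= t.+1 * 'C(k, t))%N.
Proof.
move=> letk; have := mul_bin_down k.+1 t.
rewrite -(leq_pmul2l (m := k.+1 - t)) ?subn_gt0 // => <- /=.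
rewrite mulnA leq_mul2r; apply/orP; right; nia.
Qed.

(** Past the initial zeros the corrections in [weight_rec] alternate, starting positive. Each
    negative one is outweighed by [m] times the preceding positive one, as the binomials grow by a
    factor of at most [t <= m]. *)
Lemma weight_ge0 t k : t%:Z <= m -> 0 <= weight t k.
Proof.
move=> letm; have m_ge0 : 0 <= m by apply: le_trans letm.
case: t letm => [|t] letm; first exact: exprn_ge0.
case: k => [|k]; first by rewrite weight0 exprn_ge0 ?addr_ge0.
(* As for an MDS code, the weights of index [1] to [t.+1] vanish: the binomials in [weight_rec] are
   zero there. *)
have lowE i : (i <= t)%N -> weight t.+1 i.+1 = 0.
  elim: i => [|i IHi] lti; first exact: weight1.
  by rewrite weight_rec IHi 1?ltnW // bin_small // !mulr0 addr0.
have c_ge0 : 0 <= m * (m + 1) ^+ t.+1 by rewrite mulr_ge0 ?exprn_ge0 ?addr_ge0.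
have up i : 0 <= weight t.+1 (t + i.*2).+1 -> 0 <= weight t.+1 (t + i.*2).+2.
  move=> w_ge0; rewrite weight_rec.
  have -> : (t + i.*2 + t)%N = ((t + i).*2)%N by lia.
  rewrite -[(t + i).*2]muln2 exprM sqrr_sign mul1r.
  by rewrite addr_ge0 // mulr_ge0.
have even i : 0 <= weight t.+1 (t + i.*2).+1.
  elim: i => [|i IHi]; first by rewrite addn0 lowE.
  have -> : (t + i.+1.*2).+1 = (t + i.*2).+3 by lia.
  rewrite !weight_rec.
  have -> : ((t + i.*2).+1 + t)%N = ((t + i).*2.+1)%N by lia.
  have -> : (t + i.*2 + t)%N = ((t + i).*2)%N by lia.
  rewrite [(-1) ^+ _.+1]exprS -[(t + i).*2]muln2 exprM sqrr_sign.
  set w := weight _ _ in IHi *.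
  set b := 'C((t + i.*2).+1, t); set a := 'C(t + i.*2, t).
  have leab : b%:R <= m * a%:R :> int.
    apply: le_trans (_ : (t.+1 * a)%:R <= _).
      by rewrite ler_nat bin_succ_le // leq_addr.
    by rewrite natrM ler_wpM2r ?ler0n // natz.
  rewrite (_ : _ + _ = m * m * w + m * (m + 1) ^+ t.+1 * (m * a%:R - b%:R));
    last by ring.
  rewrite -subr_ge0 in leab.
  by apply: addr_ge0; apply: mulr_ge0 => //; apply: mulr_ge0.
have [lekt|ltk] := leqP k t; first by rewrite lowE.
have [i [->|->]] : exists i, k = (t + i.*2)%N \/ k = (t + i.*2).+1.
  by exists (k - t)./2; have := odd_double_half (k - t); case: odd; lia.
- exact: even.
- exact/up/even.
Qed.

Definition weightp t (p : {poly int}) : int :=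
  \sum_(k < size p) p`_k * weight t k.

Lemma weightpE t N (p : {poly int}) : (size p <= N)%N ->
  weightp t p = \sum_(k < N) p`_k * weight t k.
Proof.
move=> lepN; rewrite /weightp (big_ord_widen _ (fun k => p`_k * weight t k) lepN).
rewrite big_mkcond; apply: eq_bigr => k _.
by case: ltnP => // lepk; rewrite nth_default ?mul0r.
Qed.

Lemma weightp_sum t (I : Type) (r : seq I) (p : I -> {poly int}) :
  weightp t (\sum_(i <- r) p i) = \sum_(i <- r) weightp t (p i).
Proof.
elim: r => [|i r IHr]; first by rewrite !big_nil /weightp size_poly0 big_ord0.
rewrite !big_cons -IHr; set q := \sum_(_ <- _) _.
pose N := maxn (size (p i)) (size q).
rewrite (weightpE t (size_polyD _ _ : (_ <= N)%N)).
rewrite (weightpE t (leq_maxl _ _ : (_ <= N)%N)).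
rewrite (weightpE t (leq_maxr _ _ : (_ <= N)%N)).
by rewrite -big_split; apply: eq_bigr => k _; rewrite coefD mulrDl.
Qed.

Lemma weightpZXn t c k : weightp t (c *: 'X^k) = c * weight t k.
Proof.
have le_size : (size (c *: 'X^k) <= k.+1)%N.
  by rewrite (leq_trans (size_scale_leq _ _)) // size_polyXn.
rewrite (weightpE _ le_size) big_ord_recr big1 /= ?add0r => [|i _].
  by rewrite coefZ coefXn eqxx mulr1.
by rewrite coefZ coefXn (ltn_eqF (ltn_ord i)) mulr0 mul0r.
Qed.

(** On [X^k] this is the defining recurrence: [weight t.+1 k.+1 + weight t.+1 k] collapses to
    [(m + 1) * weight t k]. *)
Lemma weightpS t (p : {poly int}) :
  weightp t.+1 (('X + 1) * p) = (m + 1) * weightp t p.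
Proof.
have le_size : (size (('X + 1) * p)%R <= (size p).+1)%N.
  by rewrite mulrDl mul1r mulrC (leq_trans (size_polyD _ _)) // geq_max leqnSn
    andbT (leq_trans (size_polyMleq _ _)) // size_polyX addn2.
rewrite (weightpE _ le_size) /weightp mulr_sumr.
transitivity (\sum_(k < size p) p`_k * (weight t.+1 k.+1 + weight t.+1 k)).
  under [RHS]eq_bigr do rewrite mulrDr.
  rewrite big_split /=.
  under eq_bigr do rewrite mulrDl mul1r coefD coefXM mulrDl.
  rewrite big_split /= big_ord_recl /= mul0r add0r; congr (_ + _).
  by rewrite big_ord_recr /= nth_default // mul0r addr0.
by apply: eq_bigr => k _; rewrite weightSS subrK mulrCA.
Qed.

Lemma weightp_horner t (p : {poly int}) :
  weightp t (('X + 1) ^+ t * p) = (m + 1) ^+ t * p.[m].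
Proof.
elim: t p => [|t IHt] p; last by rewrite !exprS -mulrA weightpS IHt mulrA.
by rewrite !expr0 !mul1r horner_coef.
Qed.

End Weights.

(** * Delsarte's bound for codes with large pairwise agreement *)

Section Codes.

Variables s n : nat.
Implicit Types y z w : {ffun 'I_n -> 'I_s}.

Definition agree y z := #|[set j | y j == z j]|.

Lemma agree_le y z : agree y z <= n.
Proof. by rewrite -[leqRHS]card_ord max_card. Qed.

Lemma agree_eq y z : (agree y z == n) = (y == z).
Proof.
apply/eqP/eqP => [eq_n|->]; last first.
  by rewrite -[RHS]card_ord; apply: eq_card => j; rewrite !inE eqxx.
apply/ffunP => j; apply/eqP.
have /eqP/setP/(_ j) : [set j | y j == z j] == setT.
  by rewrite eqEcard subsetT cardsT card_ord -[X in X <= _]eq_n /agree /=.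
by rewrite !inE => ->.
Qed.

Section Kernel.

Local Open Scope ring_scope.

Let m : int := s%:R - 1.

(* Each coordinate matrix (s * identity - all-ones, or all-ones) is symmetric and
   1/s times its square, so the tensor product is positive semidefinite. *)
Definition hamming_coord (J : {set 'I_n}) y z j : int :=
  if j \in J then s%:R * (y j == z j)%:R - 1 else 1.

Lemma hamming_coord_gram (J : {set 'I_n}) y z :
  s%:R ^+ n * \prod_j hamming_coord J y z j =
  \sum_w (\prod_j hamming_coord J y w j) * (\prod_j hamming_coord J z w j).
Proof.
have -> : s%:R ^+ n = \prod_(j < n) s%:R :> int by rewrite prodr_const card_ord.
rewrite -big_split /=.
pose g (b : bool) (u v : 'I_s) : int := if b then s%:R * (u == v)%:R - 1 else 1.
have gram b u v : s%:R * g b u v = \sum_x g b u x * g b v x.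
  case: b => /=; last by rewrite mulr1 sumr_const card_ord mul1r.
  have delta (c : 'I_s) : \sum_x (c == x)%:R = 1 :> int.
    rewrite (bigD1 c) //= eqxx big1 ?addr0 // => x nxc.
    by rewrite eq_sym (negPf nxc).
  have delta2 : \sum_x (u == x)%:R * (v == x)%:R = (u == v)%:R :> int.
    rewrite (bigD1 u) //= eqxx mul1r big1 ?addr0 1?eq_sym // => x nxu.
    by rewrite eq_sym (negPf nxu) mul0r.
  rewrite (eq_bigr (fun x => s%:R * s%:R * ((u == x)%:R * (v == x)%:R)
    - s%:R * (u == x)%:R - s%:R * (v == x)%:R + 1)); last by move=> x _; ring.
  rewrite !big_split /= !sumrN -!mulr_sumr delta2 !delta sumr_const card_ord.
  ring.
under [RHS]eq_bigr do rewrite -big_split.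
rewrite -(bigA_distr_bigA (fun j x => g (j \in J) (y j) x * g (j \in J) (z j) x)).
by apply: eq_bigr => j _; apply: gram.
Qed.

(** By the Gram identity, [s ^ n] times the double sum is a sum of squares indexed by [w]. *)
Lemma hamming_coord_psd (J : {set 'I_n}) (A : {set {ffun 'I_n -> 'I_s}}) :
  (0 < s)%N ->
  0 <= \sum_(y in A) \sum_(z in A) \prod_j hamming_coord J y z j.
Proof.
move=> s_gt0; rewrite -(pmulr_rge0 _ (exprn_gt0 n (_ : 0 < s%:R :> int))) ?ltr0n //.
rewrite mulr_sumr; under eq_bigr do rewrite mulr_sumr.
under eq_bigr do under eq_bigr do rewrite hamming_coord_gram.
under eq_bigr do rewrite exchange_big /=.
rewrite exchange_big /=; apply: sumr_ge0 => w _.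
under eq_bigr do rewrite -mulr_sumr.
by rewrite -mulr_suml -expr2 sqr_ge0.
Qed.

(** Generating polynomial of the Krawtchouk values at the Hamming distance of [y] and [z], the
    coefficient of [X^k] being scaled by [m^(n-k)]. *)
Definition hamming_poly y z : {poly int} :=
  \prod_j ((s%:R * (y j == z j)%:R - 1)%:P * 'X + m%:P).

Lemma hamming_polyE y z :
  hamming_poly y z = \sum_(J : {set 'I_n})
    ((m ^+ (n - #|J|) * \prod_j hamming_coord J y z j) *: 'X^#|J|).
Proof.
rewrite /hamming_poly bigA_distr; apply: eq_bigr => J _.
rewrite (bigID (mem J)) /= [X in m ^+ _ * X](bigID (mem J)) /=.
rewrite (eq_bigr (fun j => (s%:R * (y j == z j)%:R - 1)%:P * 'X)); last first.
  by move=> j ->.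
rewrite [X in _ * X](eq_bigr (fun=> m%:P)); last by move=> j /negPf->.
rewrite [X in _ * (X * _)](eq_bigr (fun j => s%:R * (y j == z j)%:R - 1)); last first.
  by move=> j jJ; rewrite /hamming_coord jJ.
rewrite [X in _ * (_ * X)](big1 _ _ (fun j => hamming_coord J y z j)); last first.
  by move=> j /negPf jJ; rewrite /hamming_coord jJ.
rewrite mulr1 big_split /= !prodr_const -rmorph_prod /=.
have -> : #|[pred j | j \notin J]| = (n - #|J|)%N.
  by rewrite -[X in (X - _)%N]card_ord -(cardC J) addKn.
rewrite -rmorphXn /= -mul_polyC rmorphM /=; ring.
Qed.

Lemma hamming_poly_agree y z :
  hamming_poly y z =
    m ^+ agree y z *:
      (('X + 1) ^+ agree y z * (m%:P - 'X) ^+ (n - agree y z)).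
Proof.
rewrite /hamming_poly (bigID (fun j => y j == z j)) /=.
rewrite (eq_bigr (fun=> m *: ('X + 1))); last first.
  by move=> j ->; rewrite mulr1 -mul_polyC mulrDr mulr1.
rewrite [X in _ * X](eq_bigr (fun=> m%:P - 'X)); last first.
  by move=> j /negPf->; rewrite mulr0 sub0r rmorphN /= mulN1r addrC.
rewrite !prodr_const.
have -> : #|[pred j | y j == z j]| = agree y z by rewrite /agree cardsE.
have -> : #|[pred j | y j != z j]| = (n - agree y z)%N.
  rewrite -[X in (X - _)%N]card_ord -(cardC [pred j | y j == z j]).
  by rewrite /agree cardsE addKn.
by rewrite exprZn scalerAl.
Qed.

(** At least [t] factors [X + 1] are present, so the functional evaluates the rest at [m], where a
    single disagreement factor [m - X] kills it. *)
Lemma weightp_hamming_poly t y z : (t <= agree y z)%N ->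
  weightp m t (hamming_poly y z) = (y == z)%:R * m ^+ n * s%:R ^+ n.
Proof.
move=> let_a; rewrite hamming_poly_agree -{2}(subnKC let_a) exprD -mulrA.
rewrite scalerAr weightp_horner.
rewrite hornerZ hornerM !horner_exp !hornerE /= subrK.
rewrite -agree_eq; have := agree_le y z; rewrite leq_eqVlt.
case: eqP => [-> _|_ /= lt_an]; last first.
  by rewrite subrr expr0n subn_eq0 leqNgt lt_an !mulr0 !mul0r.
rewrite subnn expr0 mulr1 mul1r mulrAC mulrC -exprD subnKC //.
by rewrite (leq_trans let_a) ?agree_le.
Qed.

(** Evaluates the functional on the sum of [hamming_poly] over pairs from [A] in two ways: by
    expansion over [J], and by vanishing off the diagonal. *)
Lemma weighted_code_sum t (A : {set {ffun 'I_n -> 'I_s}}) :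
  {in A &, forall y z, (t <= agree y z)%N} ->
  \sum_(J : {set 'I_n}) weight m t #|J| * m ^+ (n - #|J|) *
    (\sum_(y in A) \sum_(z in A) \prod_j hamming_coord J y z j) =
  #|A|%:R * m ^+ n * s%:R ^+ n.
Proof.
move=> tA; transitivity (\sum_(y in A) \sum_(z in A) weightp m t (hamming_poly y z)).
  under eq_bigr do rewrite mulr_sumr; rewrite exchange_big /=.
  apply: eq_bigr => y _; under eq_bigr do rewrite mulr_sumr.
  rewrite exchange_big /=; apply: eq_bigr => z _.
  rewrite hamming_polyE weightp_sum; apply: eq_bigr => J _.
  by rewrite weightpZXn; ring.
rewrite -mulrA mulr_natl -sumr_const; apply: eq_bigr => y yA.
rewrite (bigD1 y) //= weightp_hamming_poly ?tA // eqxx mul1r big1 ?addr0 //.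
move=> z /andP[zA nzy].
by rewrite weightp_hamming_poly ?tA // eq_sym (negPf nzy) !mul0r.
Qed.

Lemma agree_code_bound_int t (A : {set {ffun 'I_n -> 'I_s}}) : (1 < s)%N -> (t < s)%N ->
  {in A &, forall y z, (t <= agree y z)%N} ->
  #|A|%:R * s%:R ^+ t <= s%:R ^+ n :> int.
Proof.
move=> s_gt1 lt_ts tA.
have m_gt0 : 0 < m by rewrite subr_gt0 ltr1n.
have letm : t%:Z <= m by rewrite lerBrDr -(natz t) natr1 ler_nat.
have [->|A_gt0] := posnP #|A|; first by rewrite mul0r exprn_ge0.
(* All terms are nonnegative, so the term of [set0], which is [#|A|^2 m^n s^t], is at most the
   total. *)
have := weighted_code_sum tA; rewrite (bigD1 set0) //= => eqA.
have : #|A|%:R * m ^+ n * (#|A|%:R * s%:R ^+ t) <= #|A|%:R * m ^+ n * s%:R ^+ n.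
  rewrite -eqA -[leLHS]addr0 lerD //.
    rewrite cards0 subn0 weight0 subrK.
    have -> : \sum_(y in A) \sum_(z in A) \prod_j hamming_coord set0 y z j =
        #|A|%:R ^+ 2.
      rewrite expr2 mulr_natl -sumr_const; apply: eq_bigr => y _.
      rewrite -sumr_const; apply: eq_bigr => z _.
      by apply: big1 => j _; rewrite /hamming_coord inE.
    rewrite [leRHS](_ : _ = #|A|%:R * m ^+ n * (#|A|%:R * s%:R ^+ t)) //; ring.
  apply: sumr_ge0 => J _; apply: mulr_ge0; last exact/hamming_coord_psd/ltnW.
  by rewrite mulr_ge0 ?weight_ge0 ?exprn_ge0 // ltW.
by rewrite ler_pM2l // mulr_gt0 ?ltr0n ?exprn_gt0.
Qed.

End Kernel.

Lemma agree_code_bound t (A : {set {ffun 'I_n -> 'I_s}}) : 1 < s -> t < s ->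
  {in A &, forall y z, t <= agree y z} -> #|A| * s ^ t <= s ^ n.
Proof.
move=> s_gt1 lt_ts tA; have := agree_code_bound_int s_gt1 lt_ts tA.
by rewrite -!natrX -natrM ler_nat.
Qed.

End Codes.

(** * Negative association of the position sets of the letters *)

Section NegativeAssociation.

Variable s : nat.

Definition ucons n (c : 'I_s) (w : {ffun 'I_n -> 'I_s}) : {ffun 'I_n.+1 -> 'I_s} :=
  [ffun i => oapp w c (unlift ord0 i)].

Lemma ucons0 n c (w : {ffun 'I_n -> 'I_s}) : ucons c w ord0 = c.
Proof. by rewrite ffunE unlift_none. Qed.

Lemma uconsS n c (w : {ffun 'I_n -> 'I_s}) j : ucons c w (lift ord0 j) = w j.
Proof. by rewrite ffunE liftK. Qed.

Lemma sum_ucons n (g : {ffun 'I_n.+1 -> 'I_s} -> nat) :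
  \sum_y g y = \sum_c \sum_w g (ucons c w).
Proof.
rewrite pair_big /= (reindex (fun p => ucons p.1 p.2)) //=.
exists (fun y => (y ord0, [ffun j => y (lift ord0 j)])) => [[c w]|y] _ /=.
  by rewrite ucons0; congr (_, _); apply/ffunP => j; rewrite ffunE uconsS.
apply/ffunP => i; rewrite ffunE; case: unliftP => [j|] -> //=.
by rewrite ffunE.
Qed.

(** Used in both directions, the condition makes [f] a function of the set of [l]-positions
    alone. *)
Definition letter_mono n l (f : {ffun 'I_n -> 'I_s} -> nat) : Prop :=
  forall y z : {ffun 'I_n -> 'I_s}, (forall j, y j = l -> z j = l) -> f y <= f z.

Lemma letter_mono_ucons n l c (f : {ffun 'I_n.+1 -> 'I_s} -> nat) :
  letter_mono l f -> letter_mono l (fun w => f (ucons c w)).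
Proof.
move=> fl y z lyz; apply: fl => i.
by case: (unliftP ord0 i) => [j|] ->; rewrite ?ucons0 // !uconsS; apply: lyz.
Qed.

(** Expand the right side over the set of indices where [d] is chosen; keep only the empty set and
    the singletons. *)
Lemma prod_add_ge (I : finType) (b d : I -> nat) :
  \prod_i b i + \sum_c d c * \prod_(i | i != c) b i <= \prod_i (d i + b i).
Proof.
rewrite bigA_distr (bigD1 set0) //= leq_add //.
  by apply: leq_prod => i _; rewrite inE.
rewrite (bigID (mem [set [set x] | x in I])) /=.
apply: leq_trans (leq_addr _ _).
rewrite (eq_bigl (mem [set [set x] | x in I])) => [|J]; last first.
  change ((J != set0) && (J \in [set [set x] | x in I]) =
    (J \in [set [set x] | x in I])).
  rewrite andbC; case: imsetP => // -[x _ ->].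
  by apply/eqP => /setP/(_ x); rewrite !inE eqxx.
rewrite big_imset /=; last by move=> x y _ _; apply: set1_inj.
apply: leq_sum => c _; rewrite [leqRHS](bigD1 c) //= set11 leq_mul //.
by apply: leq_prod => i nic; rewrite inE (negPf nic).
Qed.

Lemma prod_if (I : finType) (c : I) (a b : I -> nat) :
  \prod_i (if i == c then a i else b i) = a c * \prod_(i | i != c) b i.
Proof.
rewrite (bigD1 c) //= eqxx; congr (_ * _).
by apply: eq_bigr => i /negPf->.
Qed.

(* The case of a single coordinate, where a l and b l are the values of the l-th
   function when the coordinate is l, resp. is not l. *)
Lemma negative_association_step (a b : 'I_s -> nat) : (forall l, b l <= a l) ->
  s ^ s * \sum_c \prod_l (if l == c then a l else b l) <=
  s * \prod_l (a l + s.-1 * b l).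
Proof.
move=> leba; have [s0|s_gt0] := posnP s.
  by rewrite [X in _ * X]big1 ?muln0 // => c; have := ltn_ord c; lia.
(* Split [a c] as [(a c - b c) + b c] on the left and [a l + s.-1 * b l] as [(a l - b l) + s * b l]
   on the right; the truncated subtractions are exact by [leba]. *)
apply: leq_trans (_ : s * (\prod_l (s * b l) +
    \sum_c (a c - b c) * \prod_(l | l != c) (s * b l)) <= _).
  under eq_bigr => c _ do rewrite prod_if -{1}(subnK (leba c)) mulnDl.
  rewrite big_split /= !mulnDr addnC leq_add //.
    rewrite (eq_bigr (fun=> \prod_l b l)) => [|c _]; last by rewrite [RHS](bigD1 c).
    rewrite sum_nat_const card_ord big_split /= prod_nat_const card_ord.
    by rewrite mulnCA.
  rewrite !big_distrr leq_sum //= => c _.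
  rewrite big_split /= prod_nat_const.
  have -> : #|[pred l | l != c]| = s.-1 by rewrite cardC1 card_ord.
  have -> : s ^ s = s * s ^ s.-1 by rewrite -expnS prednK.
  by apply/eq_leq; ring.
rewrite leq_mul2l; apply/orP; right.
apply: leq_trans (prod_add_ge _ _) _; apply: leq_prod => l _.
have := leba l; nia.
Qed.

(** The mean of the product is at most the product of the means, with denominators cleared.
    Induction on [n], conditioning on the first letter. *)
Lemma negative_association n (f : 'I_s -> {ffun 'I_n -> 'I_s} -> nat) : 1 < s ->
  (forall l, letter_mono l (f l)) ->
  s ^ (n * s) * \sum_y \prod_l f l y <= s ^ n * \prod_l \sum_y f l y.
Proof.
move=> s_gt1; elim: n f => [|n IHn] f fl.
  have y0 : {ffun 'I_0 -> 'I_s} by apply: finfun; case.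
  have eqy y : y = y0 by apply/ffunP; case.
  have sum0 g : \sum_(y : {ffun 'I_0 -> 'I_s}) g y = g y0.
    by rewrite (bigD1 y0) //= big1 ?addn0 // => y; rewrite (eqy y) eqxx.
  by rewrite sum0 leq_mul // leq_prod // => l _; rewrite sum0.
(* A representative first letter distinct from [l]; by [eqb] below its choice does not affect the
   sum. *)
have other l : {c : 'I_s | c != l}.
  apply/sigW; have /card_gt0P[c] : 0 < #|predC1 l|.
    by rewrite cardC1 card_ord -subn1 subn_gt0.
  by rewrite !inE => nc; exists c.
pose a l := \sum_w f l (ucons l w).
pose b l := \sum_w f l (ucons (sval (other l)) w).
have leba l : b l <= a l.
  apply: leq_sum => w _; apply: fl => i.
  by case: (unliftP ord0 i) => [j|] ->; rewrite ?uconsS ?ucons0.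
have eqb l c : l != c -> \sum_w f l (ucons c w) = b l.
  move=> nlc; apply: eq_bigr => w _; apply/eqP; rewrite eqn_leq.
  apply/andP; split; apply: fl => i;
    case: (unliftP ord0 i) => [j|] ->; rewrite ?uconsS ?ucons0 // => e.
    by rewrite e eqxx in nlc.
  by have := svalP (other l); rewrite e eqxx.
have sumf l : \sum_y f l y = a l + s.-1 * b l.
  rewrite sum_ucons (bigD1 l) //=; congr (_ + _).
  rewrite (eq_bigr (fun=> b l)) => [|c ncl]; last by rewrite eqb // eq_sym.
  by rewrite sum_nat_const cardC1 card_ord.
rewrite sum_ucons.
rewrite (eq_bigr (fun l => a l + s.-1 * b l) (F1 := fun l => \sum_y f l y)) //.
rewrite mulSn expnD expnSr -!mulnA.
(* Once the first letter is [c], the induction hypothesis applies, and the sum for [l] is [a l] or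
   [b l] according to whether [l] is [c]. *)
apply: leq_trans (_ : s ^ s * (s ^ n *
    \sum_c \prod_l (if l == c then a l else b l)) <= _).
  rewrite leq_mul2l; apply/orP; right; rewrite !big_distrr leq_sum //= => c _.
  apply: leq_trans (IHn _ (fun l => letter_mono_ucons c (fl l))) _.
  rewrite leq_mul2l; apply/orP; right; apply: leq_prod => l _.
  by case: eqP => [->|/eqP nlc] //; rewrite eqb.
by rewrite mulnCA leq_mul2l negative_association_step // orbT.
Qed.

End NegativeAssociation.

(** * Combining the bounds over all letters *)

Theorem theorem4 (s n : nat) (t : 'I_s -> nat) (F : {set {ffun 'I_n -> 'I_s}})
    (hs : 2 <= s) (hn : 0 < n)
    (ht : forall i : 'I_s, t i < s)
    (hnt : \sum_(i < s) t i <= n)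
    (hF : t_intersecting t F) :
  #|F| <= s ^ (n - \sum_(i < s) t i).
Proof.
pose U l := [set y : {ffun 'I_n -> 'I_s} |
  [exists z in F, [forall j, (z j == l) ==> (y j == l)]]].
have UP l y : y \in U l -> exists2 z, z \in F & forall j, z j = l -> y j = l.
  rewrite inE => /exists_inP[z zF /forallP zy]; exists z => // j /eqP zj.
  exact/eqP/(implyP (zy j)).
have boundU l : #|U l| * s ^ t l <= s ^ n.
  apply: agree_code_bound => // y1 y2 /UP[z1 z1F zy1] /UP[z2 z2F zy2].
  apply: leq_trans (hF _ _ z1F z2F l) (subset_leq_card _).
  apply/subsetP => j; rewrite !inE => /andP[/eqP e1 /eqP e2].
  by rewrite zy1 // zy2.
have := @negative_association s n (fun l y => y \in U l) hs.
have -> : s ^ n * \prod_l \sum_y (y \in U l) = s ^ n * \prod_l #|U l|.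
  by congr (_ * _); apply: eq_bigr => l _; rewrite -sum1_card [RHS]big_mkcond.
have leF : #|F| <= \sum_y \prod_l (y \in U l).
  rewrite -sum1_card big_mkcond leq_sum // => y _; case: ifP => // yF.
  rewrite big1 // => l _; apply/eqP; rewrite eqb1 inE; apply/exists_inP.
  by exists y => //; apply/forallP => j; apply/implyP.
move=> NA; have {}NA : s ^ (n * s) * #|F| <= s ^ n * \prod_l #|U l|.
  apply: leq_trans (NA _); first by rewrite leq_mul2l leF orbT.
  move=> l y z lyz; case yU: (y \in U l) => //.
  have [w wF wy] := UP _ _ yU; rewrite lt0b inE; apply/exists_inP; exists w => //.
  by apply/forallP => j; apply/implyP => /eqP /wy /lyz /eqP.
have s_gt0 : 0 < s by apply: ltnW.
(* Multiplying by [s ^ \sum_l t l] removes the subtraction in the exponent and lets each [s ^ t l]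
   pair with [#|U l|], as in [boundU]. *)
rewrite -(leq_pmul2r (m := s ^ \sum_l t l)) ?expn_gt0 ?s_gt0 //.
rewrite -expnD subnK // -(leq_pmul2l (m := s ^ (n * s))) ?expn_gt0 ?s_gt0 // mulnA.
apply: leq_trans (leq_mul NA (leqnn _)) _.
rewrite -mulnA mulnC leq_mul2r expn_sum -big_split /= expnM; apply/orP; right.
apply: leq_trans (leq_prod (fun l _ => boundU l)) _.
by rewrite prod_nat_const card_ord.
Qed.
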